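(* Let $K_1,\dots,K_n\in\mathcal F_0^+$ and let $p\in\mathbb R$, $p\ne-n$. Let $\Lambda_pK_i$ be the $p$-curvature image of $K_i$, i.e. the star-convex body $\Lambda_pK_i\in\mathcal S_0$ satisfying $$f_p(K_i,u)=\frac{\omega_n}{|\Lambda_pK_i|}\,\rho_{\Lambda_pK_i}(u)^{n+p},\qquad\forall u\in S^{n-1}.$$ Then $$as_p(K_1,\dots,K_n)^{n+p}=\frac{n^{n+p}\omega_n^n}{|\Lambda_pK_1|\cdots|\Lambda_pK_n|}\,\widetilde V(\Lambda_pK_1,\dots,\Lambda_pK_n)^{n+p}.$$
   Context: Notation in $\mathbb R^n$: $S^{n-1}$ is the unit sphere with spherical measure $\sigma$, $|\cdot|$ is volume, and $\omega_n$ is the volume of the Euclidean unit ball. $\mathcal K_0$ is the set of convex bodies (compact convex sets) containing the origin in their interior; $h_K(u)=\max_{x\in K}\langle x,u\rangle$. $\mathcal F_0^+$ is the set of $K\in\mathcal K_0$ whose surface area measure $S(K,\cdot)$ on $S^{n-1}$ is absolutely continuous with respect to $\sigma$ with a continuous positive density $f_K$ (curvature function). For $p\in\mathbb R$, $f_p(K,u)=h_K(u)^{1-p}f_K(u)$. $\mathcal S_0$ is the set of sets $L\subset\mathbb R^n$, star-convex about $0$, whose radial function $\rho_L(u)=\max\{\lambda\ge0:\lambda u\in L\}$, $u\in S^{n-1}$, is positive and continuous. The mixed $p$-affine surface area is $as_p(K_1,\dots,K_n)=\int_{S^{n-1}}\prod_{i=1}^n[f_p(K_i,u)]^{\frac1{n+p}}\,d\sigma(u)$.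 The dual mixed volume of $L_1,\dots,L_n\in\mathcal S_0$ is $\widetilde V(L_1,\dots,L_n)=\frac1n\int_{S^{n-1}}\prod_{i=1}^n\rho_{L_i}(u)\,d\sigma(u)$. *)

(* Defs.v *)
(* MathComp / MathComp-Analysis; R^n is 'rV[R]_n for R : realType. *)
From HB Require Import structures.
From mathcomp Require Import all_boot all_order all_algebra.
From mathcomp Require Import all_classical all_reals all_analysis.
Set Implicit Arguments.
Unset Strict Implicit.
Unset Printing Implicit Defensive.
Import Order.TTheory GRing.Theory Num.Theory.
Import numFieldTopology.Exports numFieldNormedType.Exports.
Local Open Scope classical_set_scope.
Local Open Scope ring_scope.

Section euclidean.
Variable R : realType.

Definition inner n (x y : 'rV[R]_n) : R := \sum_(i < n) x 0 i * y 0 i.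

(* The library norm on 'rV[R]_n is the sup norm: it gives the right topology
   but not the right sphere, ball or diameter. *)
Definition enorm n (x : 'rV[R]_n) : R := Num.sqrt (inner x x).

Definition sphere n : set 'rV[R]_n := [set u | enorm u = 1].
Definition eball n : set 'rV[R]_n := [set x | enorm x <= 1].

(* Lebesgue measure of R^n, as the iterated product of Lebesgue measures on the
   line: the measure of A is the integral of the measures of its sections.  The
   formula is the usual one on Borel sets; it is not meant for other sets. *)
Fixpoint lebesgue_Rn n : set 'rV[R]_n -> \bar R :=
  match n with
  | 0 => fun A => (\1_A 0)%:E
  | m.+1 => fun A => (\int[@lebesgue_measure R]_(t in setT)
      lebesgue_Rn [set v : 'rV[R]_m | A (row_mx (t%:M : 'rV[R]_1) v)])%E
  end.

Definition volume n (A : set 'rV[R]_n) : R := fine (lebesgue_Rn A).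

Definition omega n : R := volume (@eball n).

Lemma lebesgue_Rn_ge0 n (A : set 'rV[R]_n) : (0 <= lebesgue_Rn A)%E.
Proof.
elim: n A => [|n IHn] A /=; last by apply: integral_ge0 => t _; exact: IHn.
by rewrite lee_fin indicE; case: (_ \in _).
Qed.

Lemma omega_ge0 n : 0 <= omega n.
Proof. exact/fine_ge0/lebesgue_Rn_ge0. Qed.

End euclidean.

Section hausdorff.
Variables (R : realType) (n s : nat).
Local Open Scope ereal_scope.

Local Notation borel := (g_sigma_algebraType (@open 'rV[R]_n)).

Definition diam (A : set 'rV[R]_n) : \bar R :=
  ereal_sup [set (enorm (x - y))%:E | x in A & y in A].

(* Size of one covering set, normalized so that the s-dimensional Hausdorff
   measure agrees with s-dimensional volume on s-dimensional subspaces.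
   Sets of diameter larger than delta are excluded by giving them size +oo. *)
Definition gauge (delta : R) (A : set 'rV[R]_n) : \bar R :=
  if pselect (A = set0) then 0
  else if diam A <= delta%:E
       then (omega R s * (fine (diam A) / 2) ^+ s)%R%:E
       else +oo.

Lemma gauge0 delta : gauge delta set0 = 0.
Proof. by rewrite /gauge; case: pselect => // /(_ erefl). Qed.

Lemma gauge_ge0 delta A : 0 <= gauge delta A.
Proof.
rewrite /gauge; case: pselect => // A0; case: ifPn => // _.
have [x Ax] : A !=set0 by apply/set0P/eqP.
rewrite lee_fin mulr_ge0 ?omega_ge0// exprn_ge0// divr_ge0//.
apply: fine_ge0; apply: ereal_sup_ubound; exists x => //; exists x => //.
rewrite subrr /enorm /inner big1 ?sqrtr0// => i _.
by rewrite mxE mul0r.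
Qed.

(* [mu_ext] is the infimum of the sums of the sizes over countable covers; its
   covers are here by Borel sets, which changes nothing since a set and its
   closure have the same diameter. *)
Definition hausdorff_delta (delta : R) : set 'rV[R]_n -> \bar R :=
  @mu_ext _ borel R (gauge delta).

Definition hausdorff (A : set 'rV[R]_n) : \bar R :=
  ereal_sup [set hausdorff_delta delta A | delta in [set d : R | (0 < d)%R]].

Lemma hausdorff0 : hausdorff set0 = 0.
Proof.
apply/eqP; rewrite eq_le; apply/andP; split.
  apply: ge_ereal_sup => _ [d _ <-].
  by rewrite /hausdorff_delta mu_ext0//; [exact: gauge0|exact: gauge_ge0].
apply: ereal_sup_ubound; exists 1%R => //=.
by rewrite /hausdorff_delta mu_ext0//; [exact: gauge0|exact: gauge_ge0].
Qed.

Lemma hausdorff_ge0 A : 0 <= hausdorff A.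
Proof.
apply: (@le_trans _ _ (hausdorff_delta 1 A)).
  by apply: mu_ext_ge0; exact: gauge_ge0.
by apply: ereal_sup_ubound; exists 1%R => //=; exact: ltr01.
Qed.

Lemma le_hausdorff : {homo hausdorff : A B / A `<=` B >-> A <= B}.
Proof.
move=> A B AB; apply: ge_ereal_sup => _ [d d0 <-].
apply: (@le_trans _ _ (hausdorff_delta d B)); first exact: le_mu_ext.
by apply: ereal_sup_ubound; exists d.
Qed.

Lemma hausdorff_sigma_subadditive : sigma_subadditive hausdorff.
Proof.
move=> F; apply: ge_ereal_sup => _ [d d0 <-].
apply: (@le_trans _ _ (\sum_(i <oo) hausdorff_delta d (F i))).
  by apply: mu_ext_sigma_subadditive; exact: gauge_ge0.
apply: lee_nneseries => [i _ _|i _].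
  by apply: mu_ext_ge0; exact: gauge_ge0.
by apply: ereal_sup_ubound; exists d.
Qed.

HB.instance Definition _ := isOuterMeasure.Build R 'rV[R]_n hausdorff
  hausdorff0 hausdorff_ge0 le_hausdorff hausdorff_sigma_subadditive.

End hausdorff.

Section convex_geometry.
Variables (R : realType) (n : nat).
Implicit Types (K L : set 'rV[R]_n) (u : 'rV[R]_n) (p : R).

(* The spherical measure is the (n-1)-dimensional Hausdorff measure, always
   integrated over the unit sphere or one of its subsets. *)
Definition sphere_outer_measure : {outer_measure set 'rV[R]_n -> \bar R} :=
  @hausdorff R n n.-1.

Definition sigma :
    {measure set (caratheodory_type sphere_outer_measure) -> \bar R} :=
  (sphere_outer_measure : set (caratheodory_type sphere_outer_measure) -> \bar R).

Definition borel_set (A : set 'rV[R]_n) : Prop := <<s @open 'rV[R]_n >> A.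

Definition K0 K : Prop :=
  [/\ compact K, convex_set (K : set (convex_lmodType 'rV[R]_n)) & K° 0].

Definition support_function K u : R := sup [set inner x u | x in K].

(* Points of K (necessarily of its boundary) at which some element of A is an
   outer normal vector. *)
Definition reverse_spherical_image K (A : set 'rV[R]_n) : set 'rV[R]_n :=
  [set x | K x /\ exists2 u, A u & inner x u = support_function K u].

Definition surface_area_measure K (A : set 'rV[R]_n) : \bar R :=
  hausdorff n.-1 (reverse_spherical_image K A).

Definition is_curvature_function K (f : 'rV[R]_n -> R) : Prop :=
  [/\ {within @sphere R n, continuous f},
      forall u, sphere u -> 0 < f u &
      forall A, borel_set A -> A `<=` @sphere R n ->
        surface_area_measure K A = (\int[sigma]_(u in A) (f u)%:E)%E].

Definition F0plus K : Prop := K0 K /\ exists f, is_curvature_function K f.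

(* On the sphere a continuous density is unique, so that the choice of f is
   immaterial there. *)
Definition curvature_function K : 'rV[R]_n -> R :=
  xget (fun=> 0) [set f | is_curvature_function K f].

Definition p_curvature p K u : R :=
  support_function K u `^ (1 - p) * curvature_function K u.

Definition ray L u : set R := [set l | 0 <= l /\ L (l *: u)].

Definition radial_function L u : R := sup (ray L u).

(* The second clause says that the supremum is a maximum. *)
Definition S0 L : Prop :=
  [/\ forall x t, L x -> 0 <= t <= 1 -> L (t *: x),
      forall u, sphere u -> has_sup (ray L u) /\ ray L u (sup (ray L u)),
      forall u, sphere u -> 0 < radial_function L u &
      {within @sphere R n, continuous (radial_function L)}].

Definition is_p_curvature_image p K L : Prop :=
  S0 L /\ forall u, sphere u ->
    p_curvature p K u = omega R n / volume L * radial_function L u `^ (n%:R + p).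

Definition mixed_affine_surface_area p (K : 'I_n -> set 'rV[R]_n) : R :=
  \int[sigma]_(u in @sphere R n)
    \prod_(i < n) (p_curvature p (K i) u) `^ (1 / (n%:R + p)).

Definition dual_mixed_volume (L : 'I_n -> set 'rV[R]_n) : R :=
  1 / n%:R * \int[sigma]_(u in @sphere R n) \prod_(i < n) radial_function (L i) u.

End convex_geometry.

(* Main.v *)
Require Import Defs.
From mathcomp Require Import all_boot all_order all_algebra.
From mathcomp Require Import all_classical all_reals all_analysis.
Set Implicit Arguments.
Unset Strict Implicit.
Unset Printing Implicit Defensive.
Import Order.TTheory GRing.Theory Num.Theory.
Local Open Scope classical_set_scope.
Local Open Scope ring_scope.

(* The scaling lemma [ge0_integralZl] of the library asks for measurability.
   The integral of a nonnegative function being a supremum over the simple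
   functions below it, scaling by a positive constant needs none. *)
Lemma ge0_integral_pZl d (T : measurableType d) (R : realType)
    (mu : {measure set T -> \bar R}) (D : set T) (f : T -> \bar R) (r : R) :
  0 < r -> (forall x, D x -> 0 <= f x)%E ->
  (\int[mu]_(x in D) (r%:E * f x) = r%:E * \int[mu]_(x in D) f x)%E.
Proof.
move=> r0 f0.
(* One inequality is enough: scaling a simple function below [g] by [c] gives one below [c * g]. The
   converse is the same bound for [r^-1] and [r * f]. *)
have le_scale (c : R) (g : T -> \bar R) :
    0 < c -> (forall x, D x -> 0 <= g x)%E ->
    (c%:E * \int[mu]_(x in D) g x <= \int[mu]_(x in D) (c%:E * g x))%E.
  move=> c0 g0; have cg0 x : D x -> (0 <= c%:E * g x)%E.
    by move=> Dx; rewrite mule_ge0 ?lee_fin ?(ltW c0) ?g0.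
  rewrite !ge0_integralE// -ereal_sup_pZl//; apply: ge_ereal_sup.
  move=> _ [_ [h hg <-] <-]; apply: ereal_sup_ubound.
  exists (scale_nnsfun h (ltW c0)) => [x /=|]; last exact: sintegralrM.
  (* Outside [D] the restricted function is 0, so there [h x <= 0] has to survive the scaling. *)
  move: (hg x); rewrite !patchE; case: ifPn => _ hx.
    by rewrite EFinM lee_pmul2l ?fin_numE.
  by move: hx; rewrite !lee_fin pmulr_rle0.
apply/eqP; rewrite eq_le le_scale// andbT.
rewrite -lee_pdivrMl//; apply: le_trans (le_scale _ _ _ _) _.
- by rewrite invr_gt0.
- by move=> x Dx; rewrite mule_ge0 ?lee_fin ?(ltW r0) ?f0.
under eq_integral do rewrite muleA -EFinM mulVf ?gt_eqF// mul1e.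
exact: lexx.
Qed.

(* If the integral is infinite, [fine] sends both sides to 0. *)
Lemma ge0_RintegralZl d (T : measurableType d) (R : realType)
    (mu : {measure set T -> \bar R}) (D : set T) (f : T -> R) (r : R) :
  0 <= r -> (forall x, D x -> 0 <= f x) ->
  \int[mu]_(x in D) (r * f x) = r * \int[mu]_(x in D) f x.
Proof.
rewrite le_eqVlt => /predU1P[<- _|r0 f0].
  by rewrite mul0r /Rintegral integral0_eq// => x _; rewrite mul0r.
rewrite /Rintegral; under eq_integral do rewrite EFinM.
rewrite ge0_integral_pZl//.
by case: integral => [s| |]//=; rewrite ?gt0_muley ?gt0_muleNy ?lte_fin ?mulr0.
Qed.

Lemma powR_prod (R : realType) (I : finType) (F : I -> R) (x : R) :
  (forall i, 0 <= F i) -> (\prod_i F i) `^ x = \prod_i F i `^ x.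
Proof.
move=> F0.
(* The induction carries nonnegativity of the partial product, which [powRM] requires. *)
suff [] : 0 <= \prod_i F i /\ (\prod_i F i) `^ x = \prod_i F i `^ x by [].
elim/big_rec2: _ => [|i y z _ [z0 <-]]; first by rewrite powR1.
by rewrite mulr_ge0 ?powRM.
Qed.

Theorem proposition3p2 (R : realType) (n : nat) (hn : (0 < n)%N)
    (K : 'I_n -> set 'rV[R]_n) (hK : forall i, F0plus (K i))
    (p : R) (hp : p <> - n%:R)
    (Lambda : 'I_n -> set 'rV[R]_n)
    (hLambda : forall i, is_p_curvature_image p (K i) (Lambda i)) :
  mixed_affine_surface_area p K `^ (n%:R + p) =
    (n%:R `^ (n%:R + p) * omega R n ^+ n) / (\prod_(i < n) volume (Lambda i))
    * dual_mixed_volume Lambda `^ (n%:R + p).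
Proof.
set q := n%:R + p.
have q0 : q != 0 by apply/eqP => /addr0_eq np; apply: hp; rewrite -np.
have n0 : n%:R != 0 :> R by rewrite pnatr_eq0 -lt0n.
(* [volume] is 0 on sets of infinite measure, and x / 0 = 0, so [c i > 0] is not
   immediate; [c i >= 0] is enough. *)
pose c i := omega R n / volume (Lambda i).
have c0 i : 0 <= c i.
  by rewrite divr_ge0 ?omega_ge0// fine_ge0 ?lebesgue_Rn_ge0.
have rho0 i u : sphere u -> 0 <= radial_function (Lambda i) u.
  by move=> /(let: conj (And4 _ _ H _) _ := hLambda i in H u)/ltW.
pose I := \int[sigma R n]_(u in @sphere R n)
  \prod_(i < n) radial_function (Lambda i) u.
have prod_rho0 u : sphere u -> 0 <= \prod_(i < n) radial_function (Lambda i) u.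
  by move=> su; apply: prodr_ge0 => i _; exact: rho0.
(* Pointwise, [(c i * rho ^ q) ^ (1 / q) = c i ^ (1 / q) * rho], as [q != 0] and [rho >= 0]; the
   constants then leave the integral. *)
have asE : mixed_affine_surface_area p K = (\prod_i c i) `^ (1 / q) * I.
  rewrite -ge0_RintegralZl ?powR_ge0//; apply: eq_Rintegral => u /set_mem su.
  rewrite powR_prod// -big_split/=; apply: eq_bigr => i _.
  have [_ /(_ u su) ->] := hLambda i.
  rewrite -/(c i) [LHS]powRM ?powR_ge0 ?c0//.
  by rewrite -powRrM div1r mulfV// powRr1 ?rho0.
rewrite asE /dual_mixed_volume -/I [1 / n%:R]div1r.
have I0 : 0 <= I by exact: Rintegral_ge0.
have prodc0 : 0 <= \prod_i c i by exact: prodr_ge0.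
have prodcE : \prod_i c i = omega R n ^+ n / \prod_(i < n) volume (Lambda i).
  by rewrite /c big_split prodfV prodr_const card_ord.
rewrite !powRM ?powR_ge0 ?invr_ge0 ?ler0n// -powRrM div1r mulVf// powRr1//.
(* The factor [n ^ q] of the formula cancels the [1 / n] in the dual mixed volume, raised to the
   power [q]. *)
have nq : n%:R `^ q * n%:R^-1 `^ q = 1 :> R.
  by rewrite -powRM ?invr_ge0 ?ler0n// mulfV// powR1.
by rewrite prodcE -[n%:R `^ q * _ / _]mulrA mulrACA nq mul1r.
Qed.
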